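(* Fix $\varepsilon>0$ and a sign $\pm$ (the same choice throughout). Let $E(t)\in\mathbb{R}^{k\times l}$, with $\|E(t)\|_F=1$, be a solution of the norm-constrained gradient flow $$\dot E=\pm\bigl(G_\varepsilon(E)-\mu E\bigr),\qquad \mu=\langle G_\varepsilon(E),E\rangle ,$$ along which the eigenvalue $\lambda(t)$ of $M(X+L[\varepsilon E(t)])$ with smallest positive real part is simple for almost all $t$. Then at these $t$ one has $$\pm\frac{d}{dt}\,\phi_\varepsilon\bigl(E(t)\bigr)\ \ge\ 0 ,$$ and, if $G_\varepsilon(E)\neq 0$ (with $E=E(t)$), the following statements are equivalent: 1. $\frac{d}{dt}\phi_\varepsilon\bigl(E(t)\bigr)=0$. 2. $\dot E=0$. 3. $E$ is a real multiple of $G_\varepsilon(E)$.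
   Context: Setting. $A\in\mathbb{R}^{n\times n}$ (all eigenvalues with negative real part), $B\in\mathbb{R}^{n\times m}$, $C\in\mathbb{R}^{p\times n}$, $D\in\mathbb{R}^{p\times m}$, and $X=\begin{pmatrix}A&B\\ C&D\end{pmatrix}\in\mathbb{R}^{(n+p)\times(n+m)}$. $M(X)\in\mathbb{R}^{2n\times 2n}$ is one of the following two Hamiltonian matrices: either (for $p=m$ and $D+D^\top$ positive definite) $$M_p(X)=\begin{pmatrix}A&0\\ 0&-A^\top\end{pmatrix}-\begin{pmatrix}B\\ -C^\top\end{pmatrix}(D+D^\top)^{-1}\begin{pmatrix}C^\top\\ B\end{pmatrix}^\top,$$ or (for $I-D^\top D$ positive definite) $$M_b(X)=\begin{pmatrix}A&0\\ -C^\top C&-A^\top\end{pmatrix}+\begin{pmatrix}B\\ -C^\top D\end{pmatrix}(I-D^\top D)^{-1}\begin{pmatrix}C^\top D\\ B\end{pmatrix}^\top.$$ (A real matrix $N\in\mathbb R^{2n\times 2n}$ is Hamiltonian if $JN$ is symmetric, where $J=\begin{pmatrix}0&I_n\\ -I_n&0\end{pmatrix}$.) All matrices $X+L[\varepsilon E]$ that occur are assumed to lie in the domain of definition of $M$. $L:\mathbb{R}^{k\times l}\to\mathbb{R}^{(n+p)\times(n+m)}$ is a given linear map and $L^\ast$ its adjoint with respect to the Frobenius inner product $\langle U,V\rangle=\mathrm{tr}(U^\top V)$; $\|\cdot\|_F$ is the Frobenius norm. Arguments of linear maps are written in square brackets. $M'(X):\mathbb{R}^{(n+p)\times(n+m)}\to\mathbb{R}^{2n\times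 2n}$ is the derivative of $M$ at $X$ and $M'(X)^\ast$ its adjoint. For a real Hamiltonian matrix $N$, $\lambda(N)$ denotes the eigenvalue of minimal nonnegative real part (chosen with largest, nonnegative imaginary part), and $\phi_\varepsilon(E)=\mathrm{Re}\,\lambda(M(X+L[\varepsilon E]))$. The rescaled gradient is $$G_\varepsilon(E)=L^\ast\bigl[M'(X+L[\varepsilon E])^\ast[\mathrm{Re}(xy^* )]\bigr]\in\mathbb{R}^{k\times l},$$ where $x,y\in\mathbb{C}^{2n}$ are left and right eigenvectors of $M(X+L[\varepsilon E])$ to the eigenvalue $\lambda$ of minimal positive real part, normalized by $\|x\|=\|y\|=1$ (Euclidean norm) and $x^*y$ real and positive. Convention: at a time $t$ at which $\lambda(t)=\lambda(M(X+L[\varepsilon E(t)]))$ is said to be simple, $\lambda$ has positive real part and is, near $t$, a continuous path of simple eigenvalues. *)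

(* Defs.v *)
From HB Require Import structures.
From mathcomp Require Import all_boot all_order all_algebra.
From mathcomp Require Import complex.
From mathcomp Require Import all_classical all_reals all_analysis.

Set Implicit Arguments.
Unset Strict Implicit.
Unset Printing Implicit Defensive.

Import Order.TTheory GRing.Theory Num.Theory.
Import numFieldNormedType.Exports.

Local Open Scope classical_set_scope.
Local Open Scope ring_scope.
Local Open Scope complex_scope.
Local Open Scope sesquilinear_scope.

Section Frobenius.
Context {R : realType}.

Definition frob {a b : nat} (U V : 'M[R]_(a, b)) : R := \tr (U^T *m V).

Definition frob_norm {a b : nat} (U : 'M[R]_(a, b)) : R :=
  Num.sqrt (frob U U).

(* The adjoint of a linear map f, given by its entries
   <delta_ij, f^* [V]> = <f [delta_ij], V>; see adjointP and adjoint_unique. *)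
Definition adjoint {a b c d : nat} (f : 'M[R]_(a, b) -> 'M[R]_(c, d))
    (V : 'M[R]_(c, d)) : 'M[R]_(a, b) :=
  \matrix_(i, j) frob (f (delta_mx i j)) V.

Lemma frobE a b (U V : 'M[R]_(a, b)) :
  frob U V = \sum_i \sum_j U i j * V i j.
Proof.
rewrite /frob /mxtrace exchange_big /=; apply: eq_bigr => j _.
by rewrite mxE; apply: eq_bigr => i _; rewrite mxE.
Qed.

Lemma adjointP a b c d (f : {linear 'M[R]_(a, b) -> 'M[R]_(c, d)}) U V :
  frob (f U) V = frob U (adjoint f V).
Proof.
rewrite [RHS]frobE {1}(matrix_sum_delta U) /frob linear_sum linear_sum.
rewrite mulmx_suml linear_sum; apply: eq_bigr => i _ /=.
rewrite linear_sum linear_sum mulmx_suml linear_sum; apply: eq_bigr => j _ /=.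
by rewrite mxE linearZ linearZ -scalemxAl linearZ.
Qed.

Lemma adjoint_unique a b c d (f : {linear 'M[R]_(a, b) -> 'M[R]_(c, d)})
    (g : 'M[R]_(c, d) -> 'M[R]_(a, b)) :
  (forall U V, frob (f U) V = frob U (g V)) -> g = adjoint f.
Proof.
move=> fg; apply/funext => V; apply/matrixP => i j.
rewrite mxE fg frobE (bigD1 i) //= (bigD1 j) //= !mxE !eqxx mul1r.
rewrite big1 ?addr0 => [|j' /negPf j'j]; last by rewrite mxE j'j andbF mul0r.
rewrite big1 ?addr0 // => i' /negPf i'i.
by rewrite big1 // => j' _; rewrite mxE i'i mul0r.
Qed.

End Frobenius.

(* PosReal selects M_p, which is only available for p = m; BoundedReal
   selects M_b. *)
Variant ham_kind (m : nat) : nat -> Type :=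
  | PosReal : ham_kind m m
  | BoundedReal (p : nat) : ham_kind m p.
Arguments PosReal {m}.
Arguments BoundedReal {m p}.

Section HamiltonianMatrices.
Context {R : realType}.

Definition posdef {d : nat} (Q : 'M[R]_d) : Prop :=
  Q^T = Q /\ forall v : 'cV[R]_d, v != 0 -> 0 < (v^T *m Q *m v) 0 0.

Definition hurwitz {d : nat} (A : 'M[R]_d) : Prop :=
  forall z : R[i], eigenvalue (map_mx (real_complex R) A) z ->
    complex.Re z < 0.

Definition Mp {n m : nat} (X : 'M[R]_(n + m, n + m)) : 'M[R]_(n + n) :=
  let A := ulsubmx X in let B := ursubmx X in
  let C := dlsubmx X in let D := drsubmx X in
  block_mx A 0 0 (- A^T)
  - col_mx B (- C^T) *m invmx (D + D^T) *m (col_mx C^T B)^T.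

Definition Mb {n m p : nat} (X : 'M[R]_(n + p, n + m)) : 'M[R]_(n + n) :=
  let A := ulsubmx X in let B := ursubmx X in
  let C := dlsubmx X in let D := drsubmx X in
  block_mx A 0 (- (C^T *m C)) (- A^T)
  + col_mx B (- (C^T *m D)) *m invmx (1%:M - D^T *m D)
      *m (col_mx (C^T *m D) B)^T.

Definition ham_mx {n m p : nat} (h : ham_kind m p) :
    'M[R]_(n + p, n + m) -> 'M[R]_(n + n) :=
  match h in ham_kind _ q return 'M[R]_(n + q, n + m) -> 'M[R]_(n + n) with
  | PosReal => Mp
  | BoundedReal _ => Mb
  end.

Definition ham_dom {n m p : nat} (h : ham_kind m p) :
    'M[R]_(n + p, n + m) -> Prop :=
  match h in ham_kind _ q return 'M[R]_(n + q, n + m) -> Prop with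
  | PosReal => fun X => posdef (drsubmx X + (drsubmx X)^T)
  | BoundedReal _ => fun X => posdef (1%:M - (drsubmx X)^T *m drsubmx X)
  end.

End HamiltonianMatrices.

Section Eigenvalues.
Context {R : realType} {d : nat}.

Definition is_lambda (N : 'M[R]_d) (z : R[i]) : Prop :=
  [/\ eigenvalue (map_mx (real_complex R) N) z,
      0 <= complex.Re z, 0 <= complex.Im z
    & forall w : R[i], eigenvalue (map_mx (real_complex R) N) w ->
        0 <= complex.Re w ->
        complex.Re z <= complex.Re w /\
        (complex.Re w = complex.Re z -> complex.Im w <= complex.Im z)].

(* There is exactly one such z when N is Hamiltonian and d > 0, by the symmetry
   of the spectrum; otherwise the value may be the dummy 0. *)
Definition lambda (N : 'M[R]_d) : R[i] := xget 0 [set z | is_lambda N z].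

Definition simple_eigenvalue (N : 'M[R]_d) (z : R[i]) : Prop :=
  mup z (char_poly (map_mx (real_complex R) N)) = 1%N.

Definition cnorm (x : 'cV[R[i]]_d) : R[i] := sqrtC (\sum_i `|x i 0| ^+ 2).

(* x is the left and y the right eigenvector; in the order of R[i], 0 < z
   means that z is real and positive. *)
Definition eigenpair (N : 'M[R]_d) (z : R[i]) (x y : 'cV[R[i]]_d) : Prop :=
  [/\ x^t* *m map_mx (real_complex R) N = z *: x^t*,
      map_mx (real_complex R) N *m y = z *: y,
      cnorm x = 1, cnorm y = 1
    & 0 < (x^t* *m y) 0 0].

End Eigenvalues.

Section Flow.
Context {R : realType} {n m p k l : nat}.
Variables (h : ham_kind m p) (X : 'M[R]_(n + p, n + m)).
Variables (L : {linear 'M[R]_(k, l) -> 'M[R]_(n + p, n + m)}) (eps : R).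

Definition perturbed (E : 'M[R]_(k, l)) : 'M[R]_(n + p, n + m) :=
  X + L (eps *: E).

Definition lam (E : 'M[R]_(k, l)) : R[i] := lambda (ham_mx h (perturbed E)).

Definition phi (E : 'M[R]_(k, l)) : R := complex.Re (lam E).

(* When lam E is a simple eigenvalue, the normalized x and y exist and are
   unique up to a common unit factor, which Re (x y^* ) does not see, so this
   set is a singleton. *)
Definition grad (E : 'M[R]_(k, l)) : 'M[R]_(k, l) :=
  xget 0 [set g | exists x y : 'cV[R[i]]_(n + n),
    eigenpair (ham_mx h (perturbed E)) (lam E) x y /\
    g = adjoint L (adjoint ('d (@ham_mx R n m p h) (perturbed E))
          (map_mx (@complex.Re R) (x *m y^t*)))].

Definition simple_at (E : R -> 'M[R]_(k, l)) (t : R) : Prop :=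
  0 < complex.Re (lam (E t)) /\
  \forall s \near t,
    simple_eigenvalue (ham_mx h (perturbed (E s))) (lam (E s)) /\
    {for s, continuous (fun r => lam (E r) : R[i]^o)}.

(* The equation is only required where lam is simple, since the gradient is
   not defined elsewhere. *)
Definition gradient_flow (sg : R) (I : set R) (E : R -> 'M[R]_(k, l)) : Prop :=
  (forall t, I t -> {for t, continuous E}) /\
  (forall t, I t -> simple_at E t ->
     let G := grad (E t) in
     is_derive t 1 E (sg *: (G - frob G (E t) *: E t))).

End Flow.

(* Main.v *)
Require Import Defs.
From mathcomp Require Import all_boot all_order all_algebra.
From mathcomp Require Import complex ring.
From mathcomp Require Import all_classical all_reals all_analysis.

(** At a time t where the eigenvalue is simple, let P = G - <G, E> E, the
    component of G orthogonal to the unit vector E.  The flow reads E' = +-P,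
    and the gradient formula (phi o E)' = c <G, E'>, with
    c = eps / (x^* y) > 0 [is_derive_phi], gives

      +- (phi o E)' = c <G, P> = c |P|^2 >= 0.

    The derivative vanishes exactly when P = 0, that is when E' = 0, that is
    when G = <G, E> E.  For G != 0 the last equation says that E is a multiple
    of G; conversely, if E = a G then a != 0 since |E| = 1, and P = 0.

    The substance is the gradient formula, i.e. the derivative
    x^* N' y / x^* y of a simple eigenvalue lam of a differentiable matrix path
    N [is_derive_Re_simple_eigenvalue].  It would follow from differentiable
    eigenvectors, but continuous ones suffice, and the adjugate provides them
    explicitly: v(s) = adj(lam(s) - N(s)) y is an eigenvector of N(s) because
    (z - N) adj(z - N) = charpoly(z), and it tends to a nonzero multiple of y
    [simple_adj_eigenvectors].  Then
    x^* (N(s) - N(t)) v(s) = (lam(s) - lam(t)) x^* v(s), and dividing by s - t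
    gives the derivative.  The same property of the adjugate yields eigenvectors
    x and y with x^* y > 0 [simple_eigenpair_exists], so that the gradient is
    not a dummy value.

    The path N(t) = M(X + L[eps E(t)]) is differentiable because M is a
    rational function of its argument whose denominator does not vanish on the
    domain [ham_mx_differentiable]. *)

Set Implicit Arguments.
Unset Strict Implicit.
Unset Printing Implicit Defensive.

Import Order.TTheory GRing.Theory Num.Theory.
Import numFieldNormedType.Exports.

Local Open Scope classical_set_scope.
Local Open Scope ring_scope.
Local Open Scope sesquilinear_scope.

(** * The adjugate at a simple eigenvalue *)

Lemma simple_root_factor (F : fieldType) (z : F) (f : {poly F}) :
  f != 0 -> mup z f = 1%N -> exists2 q, f = ('X - z%:P) * q & q.[z] != 0.
Proof.
move=> f0 fz.
have : ('X - z%:P) ^+ 1 %| f by rewrite -mup_geq // fz.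
have : ~~ (('X - z%:P) ^+ 2 %| f) by rewrite -mup_leq // fz.
rewrite expr1 => fNz2 /dvdpP[q fE]; exists q; first by rewrite fE mulrC.
apply: contra fNz2 => qz; rewrite fE expr2 dvdp_mul2r ?polyXsubC_eq0 //.
by rewrite dvdp_XsubCl.
Qed.

Lemma horner_char_poly_mx (F : fieldType) (d : nat) (N : 'M[F]_d) (z : F) :
  map_mx (horner_eval z) (char_poly_mx N) = z%:M - N.
Proof.
apply/matrixP => i j.
by rewrite !mxE rmorphB rmorphMn /= /horner_eval hornerC hornerX.
Qed.

(** Columns of adj(z - N) are eigenvectors, or zero, because
    (z - N) adj(z - N) = charpoly(z) = 0.  They depend polynomially on N and z,
    which makes them the continuous eigenvectors used below. *)
Lemma root_char_poly_adj (F : fieldType) (d : nat) (N : 'M[F]_d) (z : F)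
    (v : 'cV[F]_d) :
  root (char_poly N) z ->
  N *m (\adj (z%:M - N) *m v) = z *: (\adj (z%:M - N) *m v).
Proof.
move=> /rootP Nz; apply/esym/eqP.
rewrite -subr_eq0 -mul_scalar_mx -mulmxBl mulmxA mul_mx_adj.
suff -> : \det (z%:M - N) = 0 by rewrite mul_scalar_mx scale0r.
by rewrite -[RHS]Nz /char_poly -horner_evalE -det_map_mx horner_char_poly_mx.
Qed.

(** At a simple eigenvalue the adjugate of z - N acts on every left and on every
    right eigenvector as multiplication by the same nonzero constant q(z), where
    charpoly = (X - z) q.  The reason is Cramer's rule over F[X]: applied to a
    left eigenvector u, the identity (X - N) adj(X - N) = (X - z) q reads
    (X - z) (u adj(X - N)) = (X - z) q u, and X - z can be cancelled before
    evaluating at z.  This replaces the usual discussion of the rank-one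
    spectral projection. *)
Lemma simple_adj_eigenvectors (F : fieldType) (d : nat) (N : 'M[F]_d) (z : F) :
  mup z (char_poly N) = 1%N ->
  exists2 c, c != 0 &
    (forall u : 'rV_d, u *m N = z *: u -> u *m \adj (z%:M - N) = c *: u) /\
    (forall v : 'cV_d, N *m v = z *: v -> \adj (z%:M - N) *m v = c *: v).
Proof.
move/(simple_root_factor (monic_neq0 (char_poly_monic N)))=> [q charE qz0].
exists q.[z] => //.
pose Nx := char_poly_mx N.
have Nx_adj : Nx *m \adj Nx = (('X - z%:P) * q)%:M by rewrite mul_mx_adj -charE.
have adj_Nx : \adj Nx *m Nx = (('X - z%:P) * q)%:M by rewrite mul_adj_mx -charE.
have eval_adj : map_mx (horner_eval z) (\adj Nx) = \adj (z%:M - N).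
  by rewrite map_mx_adj horner_char_poly_mx.
have evalC a b (w : 'M[F]_(a, b)) : map_mx (horner_eval z) (map_mx polyC w) = w.
  by apply/matrixP => i j; rewrite !mxE /horner_eval hornerC.
have evalZ a b (w : 'M[F]_(a, b)) :
    map_mx (horner_eval z) (q *: map_mx polyC w) = q.[z] *: w.
  by apply/matrixP => i j; rewrite !mxE /horner_eval hornerM hornerC.
have cancelX a b (P Q : 'M[{poly F}]_(a, b)) :
    ('X - z%:P) *: P = ('X - z%:P) *: Q -> P = Q.
  move=> /matrixP PQ; apply/matrixP => i j; move: (PQ i j); rewrite !mxE.
  by apply: mulfI; rewrite polyXsubC_eq0.
split=> w Nw.
- have : map_mx polyC w *m \adj Nx = q *: map_mx polyC w.
    apply: cancelX; rewrite [RHS]scalerA -[RHS]mul_mx_scalar -Nx_adj.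
    rewrite mulmxA scalemxAl.
    congr (_ *m _); rewrite mulmxBr mul_mx_scalar -map_mxM Nw map_mxZ scalerBl.
    by [].
  move/(congr1 (map_mx (horner_eval z))).
  by rewrite map_mxM evalC evalZ eval_adj.
- have : \adj Nx *m map_mx polyC w = q *: map_mx polyC w.
    apply: cancelX; rewrite [RHS]scalerA -[RHS]mul_scalar_mx -adj_Nx.
    rewrite -mulmxA scalemxAr.
    congr (_ *m _); rewrite mulmxBl mul_scalar_mx -map_mxM Nw map_mxZ scalerBl.
    by [].
  move/(congr1 (map_mx (horner_eval z))).
  by rewrite map_mxM evalC evalZ eval_adj.
Qed.

(** * Normalized eigenvectors of a simple eigenvalue *)

Lemma cnormZ (R : realType) (d : nat) (a : R[i]) (x : 'cV[R[i]]_d) :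
  cnorm (a *: x) = `|a| * cnorm x.
Proof.
rewrite /cnorm; under eq_bigr do rewrite mxE normrM exprMn.
rewrite -mulr_sumr rootCMl ?exprn_ge0 ?normr_ge0 //.
by rewrite sqrCK.
Qed.

Lemma cnorm_gt0 (R : realType) (d : nat) (x : 'cV[R[i]]_d) :
  (0 < cnorm x) = (x != 0).
Proof.
have sum_ge0 : 0 <= \sum_i `|x i 0| ^+ 2.
  by apply: sumr_ge0 => i _; rewrite exprn_ge0.
rewrite /cnorm lt0r sqrtC_ge0 sum_ge0 andbT sqrtC_eq0 psumr_eq0; last first.
  by move=> i _; rewrite exprn_ge0.
congr (~~ _); apply/allP/eqP => [x0|-> i _]; last first.
  by rewrite mxE normr0 expr0n eqxx.
apply/colP => i; rewrite mxE; apply/eqP.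
by rewrite -normr_eq0 -sqrf_eq0; apply: (x0 i); rewrite mem_index_enum.
Qed.

Lemma cnorm_sqr (R : realType) (d : nat) (x : 'cV[R[i]]_d) :
  (x^t* *m x) 0 0 = cnorm x ^+ 2.
Proof.
rewrite /cnorm sqrtCK mxE; apply: eq_bigr => i _.
by rewrite !mxE normCKC.
Qed.

Lemma eigenpair_normalize (R : realType) (d : nat) (N : 'M[R]_d) (z : R[i])
    (x y : 'cV[R[i]]_d) :
  x^t* *m map_mx (real_complex R) N = z *: x^t* ->
  map_mx (real_complex R) N *m y = z *: y ->
  (x^t* *m y) 0 0 != 0 ->
  exists x' y' : 'cV[R[i]]_d, eigenpair N z x' y'.
Proof.
set w := (_ *m y) 0 0 => Nx Ny w0.
have x0 : x != 0.
  by apply: contraNneq w0 => x0; rewrite /w x0 trmx0 map_mx0 mul0mx mxE.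
have y0 : y != 0 by apply: contraNneq w0 => y0; rewrite /w y0 mulmx0 mxE.
move: (x0) (y0); rewrite -!cnorm_gt0 => nx ny.
have adjZ (a : R[i]) (v : 'cV[R[i]]_d) : (a *: v)^t* = a^* *: v^t*.
  by rewrite linearZ /= map_mxZ.
(* The factor |w| / w turns the phase of x^* y into 1. *)
exists ((cnorm x)^-1 *: x), ((`|w| / w / cnorm y) *: y); split.
- by rewrite adjZ -scalemxAl Nx !scalerA mulrC.
- by rewrite -scalemxAr Ny !scalerA mulrC.
- by rewrite cnormZ ger0_norm ?invr_ge0 ?ltW // mulVf ?gt_eqF.
- rewrite cnormZ !normrM !normfV normr_id divff ?normr_eq0 // mul1r.
  by rewrite ger0_norm ?ltW // mulVf ?gt_eqF.
- rewrite adjZ -scalemxAl -scalemxAr mxE [X in _ * X]mxE -/w.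
  have -> : ((cnorm x)^-1)^* = (cnorm x)^-1.
    by apply/CrealP; rewrite ger0_real // invr_ge0 ltW.
  rewrite [X in _ * X](_ : _ = `|w| / cnorm y).
    by rewrite mulr_gt0 ?divr_gt0 ?invr_gt0 ?normr_gt0.
  by rewrite mulrAC divfK.
Qed.

Lemma simple_eigenvalue_root (R : realType) (d : nat) (N : 'M[R]_d) (z : R[i]) :
  simple_eigenvalue N z -> root (char_poly (map_mx (real_complex R) N)) z.
Proof.
move=> /(simple_root_factor (monic_neq0 (char_poly_monic _)))[q -> _].
by rewrite rootM root_XsubC eqxx.
Qed.

(** For a left eigenvector u, the column adj(z - N) u^* is a right
    eigenvector, and u adj(z - N) u^* = q(z) |u|^2 is nonzero: the two
    eigenvectors of a simple eigenvalue are never orthogonal. *)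
Lemma simple_eigenpair_exists (R : realType) (d : nat) (N : 'M[R]_d)
    (z : R[i]) :
  simple_eigenvalue N z -> exists x y : 'cV[R[i]]_d, eigenpair N z x y.
Proof.
set Nc := map_mx (real_complex R) N => zN.
have [c c0 [left_adj _]] := simple_adj_eigenvectors zN.
have chz : root (char_poly Nc) z by exact: simple_eigenvalue_root.
have /eigenvalueP[u uN u0] : eigenvalue Nc z.
  by rewrite eigenvalue_root_char.
have uK : (u^t*)^t* = u by rewrite trmxCK.
apply: (@eigenpair_normalize R d N z (u^t*) (\adj (z%:M - Nc) *m u^t*)).
- by rewrite uK.
- exact: root_char_poly_adj.
- rewrite uK mulmxA left_adj // -scalemxAl mxE mulf_neq0 //.
  rewrite -{1}uK cnorm_sqr expf_neq0 // gt_eqF // cnorm_gt0.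
  by apply: contraNneq u0 => ux; rewrite -uK ux trmx0 map_mx0.
Qed.

(** * Limits of eigenvalue difference quotients *)

Section MatrixLimits.
Context {K : numFieldType} {T : Type} {F : set_system T} {FF : Filter F}.

Lemma cvg_bigsum (I : Type) (r : seq I) (P : pred I) (f : I -> T -> K)
    (l : I -> K) :
  (forall i, P i -> f i s @[s --> F] --> l i) ->
  \sum_(i <- r | P i) f i s @[s --> F] --> \sum_(i <- r | P i) l i.
Proof. by apply: cvg_big => //; exact: add_continuous. Qed.

Lemma cvg_bigprod (I : Type) (r : seq I) (P : pred I) (f : I -> T -> K)
    (l : I -> K) :
  (forall i, P i -> f i s @[s --> F] --> l i) ->
  \prod_(i <- r | P i) f i s @[s --> F] --> \prod_(i <- r | P i) l i.
Proof. by apply: cvg_big => //; exact: mul_continuous. Qed.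

(** Entrywise limits avoid choosing a topology on complex matrices. *)
Definition cvg_entries (a b : nat) (M : T -> 'M[K]_(a, b))
    (M0 : 'M[K]_(a, b)) :=
  forall i j, M s i j @[s --> F] --> M0 i j.

Lemma cvg_entries_mul (a b c : nat) (M : T -> 'M[K]_(a, b))
    (P : T -> 'M[K]_(b, c)) M0 P0 :
  cvg_entries M M0 -> cvg_entries P P0 ->
  cvg_entries (fun s => M s *m P s) (M0 *m P0).
Proof.
move=> MM0 PP0 i j; rewrite mxE; under eq_cvg do rewrite mxE.
by apply: cvg_bigsum => k _; apply: cvgM.
Qed.

Arguments cvg_entries_mul {a b c M P M0 P0}.

Lemma cvg_entries_cst (a b : nat) (M : 'M[K]_(a, b)) :
  cvg_entries (fun=> M) M.
Proof. by move=> i j; exact: cvg_cst. Qed.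
Arguments cvg_entries_cst {a b}.

Lemma cvg_det (a : nat) (M : T -> 'M[K]_a) M0 :
  cvg_entries M M0 -> \det (M s) @[s --> F] --> \det M0.
Proof.
move=> MM0; apply: cvg_bigsum => sg _; apply: cvgM; first exact: cvg_cst.
by apply: cvg_bigprod => i _; exact: MM0.
Qed.

Lemma cvg_entries_adj (a : nat) (M : T -> 'M[K]_a) M0 :
  cvg_entries M M0 -> cvg_entries (fun s => \adj (M s)) (\adj M0).
Proof.
move=> MM0 i j; rewrite mxE; under eq_cvg do rewrite mxE.
apply: cvgM; first exact: cvg_cst.
apply: cvg_det => i' j'; rewrite !mxE; under eq_cvg do rewrite !mxE.
exact: MM0.
Qed.

(** First-order perturbation of a simple eigenvalue, for difference quotients
    along an arbitrary filter with weights w (for a derivative, w = 1/h).  The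
    curve vs s = adj(lam s - N s) v consists of eigenvectors of N s, converges
    to a nonzero multiple c v of v by [simple_adj_eigenvectors], and satisfies
    u (N s - N0) vs s = (lam s - lam0) (u vs s), so that continuity of lam is
    enough to pass to the limit. *)
Lemma cvg_simple_eigenvalue_quotient (d : nat) (N : T -> 'M[K]_d)
    (lam : T -> K) (w : T -> K) (N0 : 'M[K]_d) (lam0 : K)
    (N' : 'M[K]_d) (u : 'rV[K]_d) (v : 'cV[K]_d) :
  cvg_entries N N0 -> lam s @[s --> F] --> lam0 ->
  cvg_entries (fun s => w s *: (N s - N0)) N' ->
  (\forall s \near F, root (char_poly (N s)) (lam s)) ->
  mup lam0 (char_poly N0) = 1%N ->
  u *m N0 = lam0 *: u -> N0 *m v = lam0 *: v -> (u *m v) 0 0 != 0 ->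
  w s * (lam s - lam0) @[s --> F] --> (u *m N' *m v) 0 0 / (u *m v) 0 0.
Proof.
move=> NN0 lam_lam0 dN rootN simp uN Nv uv0.
have [c c0 [_ adjv]] := simple_adj_eigenvectors simp.
pose vs s := \adj ((lam s)%:M - N s) *m v.
have vs_c : cvg_entries vs (c *: v).
  rewrite -(adjv _ Nv); apply: cvg_entries_mul; last exact: cvg_entries_cst.
  apply: cvg_entries_adj => i j; rewrite !mxE; under eq_cvg do rewrite !mxE.
  by apply: cvgB => //; exact: cvgMn.
have quotE : \forall s \near F,
    w s * (lam s - lam0) * (u *m vs s) 0 0 =
    (u *m (w s *: (N s - N0)) *m vs s) 0 0.
  apply: filterS rootN => s.
  move=> /(root_char_poly_adj v); rewrite -/(vs s) => Nvs.
  rewrite -scalemxAr -scalemxAl mulmxBr mulmxBl -mulmxA Nvs uN.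
  by rewrite -scalemxAr -scalemxAl -scalerBl scalerA [RHS]mxE.
have uvs : (u *m vs s) 0 0 @[s --> F] --> c * (u *m v) 0 0.
  have -> : c * (u *m v) 0 0 = (u *m (c *: v)) 0 0.
    by rewrite -scalemxAr [RHS]mxE.
  exact: (cvg_entries_mul (cvg_entries_cst u) vs_c 0 0).
have cuv0 : c * (u *m v) 0 0 != 0 by rewrite mulf_neq0.
have numer : (u *m (w s *: (N s - N0)) *m vs s) 0 0 @[s --> F] -->
    c * (u *m N' *m v) 0 0.
  have -> : c * (u *m N' *m v) 0 0 = (u *m N' *m (c *: v)) 0 0.
    by rewrite -scalemxAr [RHS]mxE.
  apply: (cvg_entries_mul _ vs_c 0 0).
  exact: cvg_entries_mul (cvg_entries_cst u) dN.
have -> : (u *m N' *m v) 0 0 / (u *m v) 0 0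
    = c * (u *m N' *m v) 0 0 / (c * (u *m v) 0 0).
  by rewrite invfM mulrACA divff // mul1r.
apply: cvg_trans (cvgM numer (cvgV cuv0 uvs)).
apply: near_eq_cvg.
have uvs0 : \forall s \near F, (u *m vs s) 0 0 != 0.
  exact: (cvgr_neq0 _ uvs cuv0).
near=> s.
rewrite /= -(near quotE s) // mulfK //.
by near: s.
Unshelve. all: by end_near. Qed.

End MatrixLimits.

Section ComplexLimits.
Context {R : realType} {T : Type} {F : set_system T} {FF : Filter F}.

Lemma cvg_complexRe (f : T -> R[i]) (z : R[i]) :
  (f : T -> R[i]^o) @ F --> (z : R[i]^o) ->
  complex.Re (f s) @[s --> F] --> complex.Re z.
Proof.
move=> /cvgrPdist_lt fz; apply/cvgrPdist_lt => e e0.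
have ec0 : 0 < real_complex R e by rewrite ltcR.
apply: filterS (fz _ ec0) => s fzs.
rewrite -ltcR; apply: le_lt_trans fzs.
rewrite -[X in `|X|](_ : complex.Re (z - f s) = _); first exact: normc_ge_Re.
by case: z {fz} (f s) => [a b] [a' b'].
Qed.

Lemma cvg_real_complex (f : T -> R) (a : R) :
  f @ F --> a ->
  (fun s => real_complex R (f s) : R[i]^o) @ F --> (real_complex R a : R[i]^o).
Proof.
move=> /cvgrPdist_lt fa; apply/cvgrPdist_lt => e e0.
move: (e0); rewrite ltcE => /andP[/eqP/= ie re].
apply: filterS (fa _ re) => s fas.
have -> : e = real_complex R (complex.Re e) by case: (e) ie => p q /= ->.
by rewrite -rmorphB normc_def /= expr0n addr0 sqrtr_sqr ltcR.
Qed.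

End ComplexLimits.

(** * The derivative of a simple eigenvalue *)

Lemma Re_sesquilinear_frob (R : realType) (d : nat) (M : 'M[R]_d)
    (x y : 'cV[R[i]]_d) :
  complex.Re ((x^t* *m map_mx (real_complex R) M *m y) 0 0) =
  frob (map_mx (@complex.Re R) (x *m y^t*)) M.
Proof.
have ReD : {morph (@complex.Re R) : a b / a + b} by move=> [? ?] [? ?].
rewrite frobE exchange_big /= mxE (big_morph _ ReD (erefl : complex.Re 0 = 0)).
apply: eq_bigr => j _.
rewrite mxE mulr_suml (big_morph _ ReD (erefl : complex.Re 0 = 0)).
apply: eq_bigr => i _; rewrite !mxE big_ord1 !mxE.
case: (x i 0) (y j 0) => [a b] [c e] /=.
by ring.
Qed.

(** The classical formula lambda' = x^* N' y / x^* y, whose denominator is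
    real by normalization; its real part is linear in N', with
    Frobenius representative the real part of x y^* over x^* y. *)
Lemma is_derive_Re_simple_eigenvalue (R : realType) (d : nat)
    (N : R -> 'M[R]_d) (lam : R -> R[i]) (t : R) (x y : 'cV[R[i]]_d)
    (N' : 'M[R]_d) :
  {for t, continuous (lam : R -> R[i]^o)} ->
  (\forall s \near t, simple_eigenvalue (N s) (lam s)) ->
  eigenpair (N t) (lam t) x y ->
  is_derive t 1 N N' ->
  is_derive t 1 (fun s => complex.Re (lam s))
    (frob (map_mx (@complex.Re R) (x *m y^t*)) N'
       / complex.Re ((x^t* *m y) 0 0)).
Proof.
move=> lamc simp [xN Ny _ _ xy_gt0] [dN dN'].
have shift_t : h + t @[h --> (0 : R)^'] --> t.
  apply: cvg_within_filter.
  suff : h + t @[h --> (0 : R)] --> 0 + t by rewrite add0r.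
  by apply: cvgD; [exact: cvg_id|exact: cvg_cst].
have Nc : {for t, continuous N}.
  exact/differentiable_continuous/derivable1_diffP.
have dNlim : h^-1 *: (N (h + t) - N t) @[h --> (0 : R)^'] --> N'.
  rewrite -dN' /derive.
  apply: cvg_trans dN; apply: near_eq_cvg; near=> h.
  by rewrite /= [h *: 1]mulr1.
have entry i j (f : R -> 'M[R]_d) (M0 : 'M[R]_d) :
    f h @[h --> (0 : R)^'] --> M0 ->
    f h i j @[h --> (0 : R)^'] --> M0 i j.
  by move=> fM; exact: (cvg_comp _ _ fM (@coord_continuous R d d i j M0)).
pose NC s := map_mx (real_complex R) (N s).
have quot :
    (real_complex R h)^-1 * (lam (h + t) - lam t) @[h --> (0 : R)^'] -->
    ((x^t* *m map_mx (real_complex R) N' *m y) 0 0 / (x^t* *m y) 0 0 : R[i]^o).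
  apply: (@cvg_simple_eigenvalue_quotient (R[i]) _ _ _ d
    (fun h => NC (h + t)) (fun h => lam (h + t))
    (fun h => (real_complex R h)^-1) (NC t) (lam t)) => //.
  - move=> i j; rewrite mxE; under eq_cvg do rewrite mxE.
    apply: cvg_real_complex; apply: (entry i j (fun h => N (h + t))).
    exact: cvg_comp shift_t Nc.
  - exact: cvg_comp shift_t lamc.
  - move=> i j; rewrite mxE.
    under eq_cvg => h.
      rewrite !mxE -rmorphB -fmorphV -rmorphM /=.
      over.
    apply: cvg_real_complex.
    apply: cvg_trans (entry i j _ _ dNlim); apply: near_eq_cvg; near=> h.
    by rewrite !mxE.
  - apply: (shift_t [set s | root (char_poly (NC s)) (lam s)]).
    apply: filterS simp => s sN /=.
    exact: simple_eigenvalue_root.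
  - exact: (nbhs_singleton simp).
  - by rewrite gt_eqF.
have ReQ :
    h^-1 *: (complex.Re (lam (h *: 1 + t)) - complex.Re (lam t))
      @[h --> (0 : R)^'] -->
    frob (map_mx (@complex.Re R) (x *m y^t*)) N'
      / complex.Re ((x^t* *m y) 0 0).
  have -> : frob (map_mx (@complex.Re R) (x *m y^t*)) N'
      / complex.Re ((x^t* *m y) 0 0) =
      complex.Re ((x^t* *m map_mx (real_complex R) N' *m y) 0 0
                    / (x^t* *m y) 0 0).
    rewrite -Re_sesquilinear_frob.
    case: ((x^t* *m y) 0 0) xy_gt0 => a b; rewrite ltcE /= => /andP[/eqP -> a0].
    case: ((_ *m y) 0 0) => c e /=; field.
    by rewrite gt_eqF.
  apply: cvg_trans (cvg_complexRe quot).
  apply: near_eq_cvg; near=> h.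
  rewrite [h *: 1]mulr1 -fmorphV.
  by case: (lam _) (lam _) => a b [c e] /=; rewrite mul0r subr0.
split; first by apply/cvg_ex; eexists; exact: ReQ.
exact: cvg_lim ReQ.
Unshelve. all: by end_near. Qed.

(** * Differentiability of the Hamiltonian matrices *)

Lemma near_eq_differentiable (R : numFieldType) (V W : normedModType R)
    (f g : V -> W) (x : V) :
  (\forall v \near x, f v = g v) -> differentiable f x -> differentiable g x.
Proof.
move=> fg df; have [dfc dfE] := (diff_locallyP _ _).1 df.
have gE : g \o shift x = cst (g x) + 'd f x +o_ 0 id.
  apply/eqaddoP => e e0; move/eqaddoP: dfE => /(_ _ e0).
  move: (fg); rewrite (near_shift 0) subr0; apply: filterS2 => v /= fgv.
  by rewrite !fctE /= -(nbhs_singleton fg) -fgv.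
apply/diff_locallyP.
have dg := diff_unique dfc gE.
by rewrite dg.
Qed.

Section MatrixDifferentiability.
Context {R : realType} {V : normedModType R} (x : V).

Lemma differentiable_bigsum (W : normedModType R) (I : Type) (r : seq I)
    (P : pred I) (f : I -> V -> W) :
  (forall i, P i -> differentiable (f i) x) ->
  differentiable (fun v => \sum_(i <- r | P i) f i v) x.
Proof.
move=> df.
rewrite (_ : (fun v => _) = \sum_(i <- r | P i) f i); last first.
  by apply/funext => v; rewrite fct_sumE.
by elim/big_ind : _ => // ? ? g h; exact: differentiableD.
Qed.

Lemma differentiable_bigprod (I : Type) (r : seq I) (P : pred I)
    (f : I -> V -> R) :
  (forall i, P i -> differentiable (f i) x) ->
  differentiable (fun v => \prod_(i <- r | P i) f i v) x.
Proof.
move=> df.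
rewrite (_ : (fun v => _) = \prod_(i <- r | P i) f i); last first.
  by apply/funext => v; rewrite fct_prodE.
by elim/big_ind : _ => // ? ? g h; exact: differentiableM.
Qed.

Lemma differentiable_mxP (a b : nat) (M : V -> 'M[R]_(a, b)) :
  differentiable M x <-> forall i j, differentiable (fun v => M v i j) x.
Proof.
split=> [dM i j|dM].
  exact: (differentiable_comp dM (differentiable_coord _ i j)).
rewrite (_ : M = fun v => \sum_i \sum_j (M v i j) *: delta_mx i j); last first.
  by apply/funext => v; rewrite -matrix_sum_delta.
apply: differentiable_bigsum => i _; apply: differentiable_bigsum => j _.
exact: differentiableZl.
Qed.

Lemma differentiable_mulmx (a b c : nat) (M : V -> 'M[R]_(a, b))
    (P : V -> 'M[R]_(b, c)) :
  differentiable M x -> differentiable P x ->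
  differentiable (fun v => M v *m P v) x.
Proof.
move=> /differentiable_mxP dM /differentiable_mxP dP.
apply/differentiable_mxP => i j; under eq_fun do rewrite mxE.
by apply: differentiable_bigsum => k _; apply: differentiableM.
Qed.

Lemma differentiable_trmx (a b : nat) (M : V -> 'M[R]_(a, b)) :
  differentiable M x -> differentiable (fun v => (M v)^T) x.
Proof.
move=> /differentiable_mxP dM.
by apply/differentiable_mxP => i j; under eq_fun do rewrite mxE.
Qed.

Lemma differentiable_row_mx (a b c : nat) (M : V -> 'M[R]_(a, b))
    (P : V -> 'M[R]_(a, c)) :
  differentiable M x -> differentiable P x ->
  differentiable (fun v => row_mx (M v) (P v)) x.
Proof.
move=> /differentiable_mxP dM /differentiable_mxP dP.
apply/differentiable_mxP => i j; under eq_fun do rewrite mxE.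
by case: (fintype.split j) => k.
Qed.

Lemma differentiable_col_mx (a b c : nat) (M : V -> 'M[R]_(a, c))
    (P : V -> 'M[R]_(b, c)) :
  differentiable M x -> differentiable P x ->
  differentiable (fun v => col_mx (M v) (P v)) x.
Proof.
move=> /differentiable_mxP dM /differentiable_mxP dP.
apply/differentiable_mxP => i j; under eq_fun do rewrite mxE.
by case: (fintype.split i) => k.
Qed.

Lemma differentiable_det (a : nat) (M : V -> 'M[R]_a) :
  differentiable M x -> differentiable (fun v => \det (M v)) x.
Proof.
move=> /differentiable_mxP dM; apply: differentiable_bigsum => s _.
apply: differentiableM; first exact: differentiable_cst.
by apply: differentiable_bigprod => i _; exact: dM.
Qed.

Lemma differentiable_adj (a : nat) (M : V -> 'M[R]_a) :
  differentiable M x -> differentiable (fun v => \adj (M v)) x.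
Proof.
move=> /differentiable_mxP dM; apply/differentiable_mxP => i j.
under eq_fun do rewrite mxE.
apply: differentiableM; first exact: differentiable_cst.
apply: differentiable_det; apply/differentiable_mxP => i' j'.
by under eq_fun do rewrite !mxE.
Qed.

(** Cramer's formula for the inverse holds where the determinant is nonzero,
    hence only near x. *)
Lemma differentiable_invmx (a : nat) (M : V -> 'M[R]_a) :
  differentiable M x -> M x \in unitmx ->
  differentiable (fun v => invmx (M v)) x.
Proof.
move=> dM uM.
have detx0 : \det (M x) != 0 by rewrite -unitfE -unitmxE.
have ddet := differentiable_det dM.
apply: (@near_eq_differentiable _ _ _ (fun v => (\det (M v))^-1 *: \adj (M v))).
  have : \forall v \near x, \det (M v) != 0.
    exact: (cvgr_neq0 _ (differentiable_continuous ddet) detx0).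
  by apply: filterS => v detv; rewrite /invmx unitmxE unitfE detv.
apply/differentiable_mxP => i j; under eq_fun do rewrite mxE.
apply: differentiableM; first exact: differentiableV.
by move/differentiable_adj/differentiable_mxP: dM; exact.
Qed.

End MatrixDifferentiability.

(** A linear map out of a matrix space is a finite combination of
    coordinates. *)
Lemma differentiable_linear_mx (R : realType) (W : normedModType R) (a b : nat)
    (f : {linear 'M[R]_(a, b) -> W}) (x : 'M[R]_(a, b)) : differentiable f x.
Proof.
rewrite (_ : f = (fun v => \sum_i \sum_j (v i j) *: f (delta_mx i j))
                 :> (_ -> _)); last first.
  apply/funext => v; rewrite {1}(matrix_sum_delta v) linear_sum.
  apply: eq_bigr => i _; rewrite linear_sum; apply: eq_bigr => j _.
  by rewrite linearZ.
apply: differentiable_bigsum => i _; apply: differentiable_bigsum => j _.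
apply: differentiableZl; exact: differentiable_coord.
Qed.

Lemma posdef_unitmx (R : realType) (d : nat) (Q : 'M[R]_d) :
  posdef Q -> Q \in unitmx.
Proof.
move=> [_ Qpos]; rewrite unitmxE unitfE; apply/det0P => -[v v0 vQ].
have := Qpos v^T; rewrite trmxK vQ mul0mx mxE ltxx => /(_ _)/notF; apply.
by apply: contra v0 => /eqP vT0; rewrite -[v]trmxK vT0 trmx0.
Qed.

(** Both Hamiltonian matrices are rational in X, and their only denominator is
    the determinant of a matrix that is positive definite on the domain. *)
Lemma ham_mx_differentiable (R : realType) (n m p : nat) (h : ham_kind m p)
    (X : 'M[R]_(n + p, n + m)) :
  ham_dom h X -> differentiable (ham_mx h) X.
Proof.
have blocks q (Y0 : 'M[R]_(n + q, n + m)) :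
  [/\ differentiable (fun Y : 'M[R]_(n + q, n + m) => ulsubmx Y) Y0,
      differentiable (fun Y : 'M[R]_(n + q, n + m) => ursubmx Y) Y0,
      differentiable (fun Y : 'M[R]_(n + q, n + m) => dlsubmx Y) Y0 &
      differentiable (fun Y : 'M[R]_(n + q, n + m) => drsubmx Y) Y0].
  split; apply/differentiable_mxP => i j; under eq_fun do rewrite !mxE;
    exact: differentiable_coord.
case: h X => [|p'] X /= X_dom; have [dA dB dC dD] := blocks _ X.
- apply: differentiableB.
    apply: differentiable_col_mx; apply: differentiable_row_mx;
      try exact: differentiable_cst.
    by [].
    exact/differentiableN/differentiable_trmx.
  apply: differentiable_mulmx; first apply: differentiable_mulmx.
  + apply: differentiable_col_mx => //.
    exact/differentiableN/differentiable_trmx.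
  + apply: differentiable_invmx; last exact: posdef_unitmx.
    by apply: differentiableD => //; exact: differentiable_trmx.
  + apply: differentiable_trmx; apply: differentiable_col_mx => //.
    exact: differentiable_trmx.
- have dCt := differentiable_trmx dC; have dDt := differentiable_trmx dD.
  apply: differentiableD.
    apply: differentiable_col_mx; apply: differentiable_row_mx.
    + by [].
    + exact: differentiable_cst.
    + exact/differentiableN/differentiable_mulmx.
    + exact/differentiableN/differentiable_trmx.
  apply: differentiable_mulmx; first apply: differentiable_mulmx.
  + apply: differentiable_col_mx => //.
    exact/differentiableN/differentiable_mulmx.
  + apply: differentiable_invmx; last exact: posdef_unitmx.
    apply: differentiableB; first exact: differentiable_cst.
    exact: differentiable_mulmx.
  + apply: differentiable_trmx; apply: differentiable_col_mx => //.
    exact: differentiable_mulmx.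
Qed.

(** * The gradient of phi *)

Lemma frobC (R : realType) (a b : nat) (U V : 'M[R]_(a, b)) :
  frob U V = frob V U.
Proof. by rewrite /frob -mxtrace_tr trmx_mul trmxK. Qed.

Lemma frobZr (R : realType) (a b : nat) (c : R) (U V : 'M[R]_(a, b)) :
  frob U (c *: V) = c * frob U V.
Proof. by rewrite /frob -scalemxAr mxtraceZ. Qed.

Lemma frobBr (R : realType) (a b : nat) (U V W : 'M[R]_(a, b)) :
  frob U (V - W) = frob U V - frob U W.
Proof. by rewrite /frob mulmxBr raddfB. Qed.

Lemma frob_ge0 (R : realType) (a b : nat) (U : 'M[R]_(a, b)) : 0 <= frob U U.
Proof.
rewrite frobE; apply: sumr_ge0 => i _; apply: sumr_ge0 => j _.
by rewrite -expr2 sqr_ge0.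
Qed.

Lemma frob_eq0 (R : realType) (a b : nat) (U : 'M[R]_(a, b)) :
  (frob U U == 0) = (U == 0).
Proof.
apply/eqP/eqP => [U0|->]; last by rewrite /frob mulmx0 mxtrace0.
have sqU_ge0 i j : 0 <= U i j * U i j by rewrite -expr2 sqr_ge0.
have rowU_ge0 i : 0 <= \sum_j U i j * U i j by apply: sumr_ge0.
apply/matrixP => i j; rewrite mxE; apply/eqP; rewrite -sqrf_eq0 expr2.
move: U0; rewrite frobE => /eqP; rewrite psumr_eq0 // => /allP/(_ i).
rewrite mem_index_enum => /(_ isT); rewrite psumr_eq0 // => /allP/(_ j).
by rewrite mem_index_enum; exact.
Qed.

Lemma is_derive_ham_mx (R : realType) (n m p k l : nat) (h : ham_kind m p)
    (X : 'M[R]_(n + p, n + m))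
    (L : {linear 'M[R]_(k, l) -> 'M[R]_(n + p, n + m)}) (eps : R)
    (E : R -> 'M[R]_(k, l)) (t : R) (D : 'M[R]_(k, l)) :
  ham_dom h (perturbed X L eps (E t)) -> is_derive t 1 E D ->
  is_derive t 1 (fun s => ham_mx h (perturbed X L eps (E s)))
    ('d (@ham_mx R n m p h) (perturbed X L eps (E t))
       (L (eps *: D))).
Proof.
move=> dom [dE dED].
have dE' : differentiable E t by exact/derivable1_diffP.
have dL Y : is_diff Y L L.
  apply: DiffDef; first exact: differentiable_linear_mx.
  apply: diff_lin => Z.
  exact/differentiable_continuous/differentiable_linear_mx.
have dP : is_diff (E t) (perturbed X L eps) (L \o ( *:%R eps)).
  have dS := is_diff_scaler eps (E t).
  have dLS := is_diff_comp dS (dL (eps *: E t)).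
  have dXL := is_diffD (is_diff_cst X (E t)) dLS.
  rewrite -[X in is_diff_def _ _ X]add0r.
  exact: dXL.
have dham := ham_mx_differentiable dom.
have dPE : differentiable (perturbed X L eps \o E) t.
  exact: differentiable_comp.
have dN : differentiable (ham_mx h \o (perturbed X L eps \o E)) t.
  exact: differentiable_comp.
split; first exact: diff_derivable.
have dPE1 : 'd (perturbed X L eps \o E) t 1 = L (eps *: D).
  rewrite (diff_comp dE' (@ex_diff _ _ _ _ _ _ _ dP)) /= diff_val /=.
  by rewrite -(deriveE _ dE') dED.
by rewrite [LHS](deriveE _ dN) (diff_comp dPE dham) /= dPE1.
Qed.

(** Up to the positive factor c = eps / (x^* y), the rescaled gradient is the
    gradient of phi: moving M'(X) and L to the other side of the Frobenius
    product turns the eigenvalue formula into an inner product with D.  The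
    formula holds for every admissible pair (x, y), hence for the chosen one. *)
Lemma is_derive_phi (R : realType) (n m p k l : nat) (h : ham_kind m p)
    (X : 'M[R]_(n + p, n + m))
    (L : {linear 'M[R]_(k, l) -> 'M[R]_(n + p, n + m)}) (eps : R)
    (E : R -> 'M[R]_(k, l)) (t : R) (D : 'M[R]_(k, l)) :
  0 < eps -> ham_dom h (perturbed X L eps (E t)) -> simple_at h X L eps E t ->
  is_derive t 1 E D ->
  exists2 c, 0 < c &
    is_derive t 1 (fun r => phi h X L eps (E r))
      (c * frob (grad h X L eps (E t)) D).
Proof.
move=> eps0 dom [_ simp] dE.
have [simp_t lam_cont] := nbhs_singleton simp.
have [x0 [y0 xy0]] := simple_eigenpair_exists simp_t.
rewrite /grad; case: xgetP => [G _ [x [y [xy ->]]]|noG]; last first.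
  (* The set of candidate gradients is nonempty: the dummy value is excluded. *)
  by exfalso; apply: noG; exists x0, y0; split; [exact: xy0|reflexivity].
have [_ _ _ _ xy_gt0] := xy.
exists (eps / complex.Re ((x^t* *m y) 0 0)).
  by rewrite divr_gt0 //; move: xy_gt0; rewrite ltcE => /andP[].
apply: is_derive_eq.
  have dN := is_derive_ham_mx dom dE.
  apply: (is_derive_Re_simple_eigenvalue lam_cont _ xy dN).
  by apply: filterS simp => s [].
by rewrite frobC adjointP adjointP frobC frobZr mulrAC.
Qed.

(** * The constrained gradient flow *)

Local Close Scope sesquilinear_scope.

Theorem theorem2p5 (R : realType) (n m p k l : nat) (h : ham_kind m p)
    (X : 'M[R]_(n + p, n + m))
    (A_stable : hurwitz (ulsubmx X)) (X_dom : ham_dom h X)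
    (L : {linear 'M[R]_(k, l) -> 'M[R]_(n + p, n + m)})
    (eps : R) (eps_gt0 : 0 < eps)
    (sg : R) (sgE : sg = 1 \/ sg = -1)
    (I : set R) (I_open : open I) (I_itv : is_interval I)
    (E : R -> 'M[R]_(k, l))
    (E_dom : forall t, I t -> ham_dom h (perturbed X L eps (E t)))
    (E_norm : forall t, I t -> frob_norm (E t) = 1)
    (E_flow : gradient_flow h X L eps sg I E)
    (E_simple : {ae lebesgue_measure,
                  forall t : R, I t -> simple_at h X L eps E t})
    (t : R) (It : I t) (t_simple : simple_at h X L eps E t) :
  let phiE := fun r => phi h X L eps (E r) in
  let G := grad h X L eps (E t) in
  [/\ derivable phiE t 1,
      0 <= sg * derive1 phiE t
    & G != 0 ->
      [<-> derive1 phiE t = 0;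
           derive1 E t = 0;
           exists c : R, E t = c *: G]].
Proof.
move=> phiE G.
have dE := E_flow.2 t It t_simple; rewrite -/G /= in dE.
set P := G - frob G (E t) *: E t in dE.
have EE : frob (E t) (E t) = 1.
  have := congr1 (fun r => r ^+ 2) (E_norm t It).
  by rewrite sqr_sqrtr ?frob_ge0 // expr1n.
have EP : frob (E t) P = 0 by rewrite frobBr frobZr EE mulr1 frobC subrr.
have GP : frob G P = frob P P.
  have -> : frob P P = frob P G - frob G (E t) * frob P (E t).
    by rewrite -frobZr -frobBr.
  by rewrite (frobC P (E t)) EP mulr0 subr0 frobC.
have sg2 : sg * sg = 1 by case: sgE => ->; rewrite ?mulrNN mulr1.
have sg0 : sg != 0.
  by apply: contra_eq_neq sg2 => ->; rewrite mul0r eq_sym oner_eq0.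
have [c c0 dphi] := is_derive_phi eps_gt0 (E_dom t It) t_simple dE.
have phi'E : derive1 phiE t = sg * (c * frob P P).
  by rewrite derive1E (@derive_val _ _ _ _ _ _ _ dphi) -/G frobZr GP mulrCA.
have E'E : derive1 E t = sg *: P.
  by rewrite derive1E (@derive_val _ _ _ _ _ _ _ dE).
split.
- by case: dphi.
- by rewrite phi'E mulrA sg2 mul1r mulr_ge0 ?frob_ge0 // ltW.
move=> G0; tfae.
- move/eqP; rewrite phi'E !mulf_eq0 (negPf sg0) (gt_eqF c0) /= frob_eq0.
  by move=> /eqP P0; rewrite E'E P0 scaler0.
- move/eqP; rewrite E'E scaler_eq0 (negPf sg0) /= subr_eq0 => /eqP GE.
  exists (frob G (E t))^-1; rewrite {2}GE scalerA mulVf ?scale1r //.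
  by apply: contraNneq G0 => mu0; rewrite GE mu0 scale0r.
- move=> [a Ea].
  have a0 : a != 0.
    apply: contra_eq_neq EE => a0.
    by rewrite Ea a0 scale0r /frob mulmx0 mxtrace0 eq_sym oner_eq0.
  have GE : G = a^-1 *: E t by rewrite Ea scalerA mulVf ?scale1r.
  suff P0 : P = 0 by rewrite phi'E P0 /frob mulmx0 mxtrace0 !mulr0.
  apply/eqP; rewrite subr_eq0; apply/eqP.
  by rewrite {2}GE [frob _ (E t)]frobC frobZr EE mulr1.
Qed.
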